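(* Let $t>0$ and $\delta\in(0,1)$. With probability at least $1-4\delta$, the following two inequalities both hold: $$M_0(t)\le G_0(t)+\frac1t\left(\sqrt{6K(t)\log\frac1\delta}+5\log\frac1\delta\right),$$ $$M_0(t)\ge G_0(t)-\frac1t\left(\sqrt{2\left(K_1(t)+2K_2(t)\right)\log\frac1\delta}+4\log\frac1\delta\right).$$
   Context: Let $(p_j)_{j\ge1}$ be a probability mass function on the positive integers, and let $U_1,U_2,\dots$ be i.i.d. with $\mathbb{P}(U_i=j)=p_j$. Poisson setting: $N(t)$ is a Poisson random variable with mean $t$, independent of $(U_i)$; $X_j(t)=\sum_{i=1}^{N(t)}\mathbb{I}_{\{U_i=j\}}$ (so the $X_j(t)$, $j\ge1$, are independent Poisson with means $tp_j$); $K(t)=\sum_{j\ge1}\mathbb{I}_{\{X_j(t)>0\}}$; $K_r(t)=\sum_{j\ge1}\mathbb{I}_{\{X_j(t)=r\}}$; missing mass $M_0(t)=\sum_{j\ge1}p_j\mathbb{I}_{\{X_j(t)=0\}}$; Good--Turing estimator $G_0(t)=K_1(t)/t$. *)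

(* Defs.v *)
From HB Require Import structures.
From mathcomp Require Import all_boot all_order all_algebra finmap.
From mathcomp Require Import all_classical all_reals all_analysis.

Set Implicit Arguments.
Unset Strict Implicit.
Unset Printing Implicit Defensive.

Import Order.TTheory GRing.Theory Num.Theory.

Local Open Scope classical_set_scope.
Local Open Scope ring_scope.

Definition positive_pmf (R : realType) (p : nat -> R) : Prop :=
  (forall j, (1 <= j)%N -> 0 <= p j) /\
  (\sum_(1 <= j <oo) (p j)%:E = 1)%E.

Definition mutually_independent d d' (T : measurableType d)
    (T' : measurableType d') (R : realType) (P : probability T R)
    (I : choiceType) (X : I -> {RV P >-> T'}) : Prop :=
  forall (J : {fset I}) (B : I -> set T'),
    (forall i, i \in J -> measurable (B i)) ->
    (P (\bigcap_(i in [set` J]) X i @^-1` B i) =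
     \prod_(i <- J) P (X i @^-1` B i))%E.

Definition family_sigma_algebra d d' (T : measurableType d)
    (T' : measurableType d') (R : realType) (P : probability T R)
    (I : Type) (X : I -> {RV P >-> T'}) : set (set T) :=
  <<s \bigcup_i preimage_set_system [set: T] (X i) measurable >>.

Definition independent_of_family d d1 d2 (T : measurableType d)
    (T1 : measurableType d1) (T2 : measurableType d2) (R : realType)
    (P : probability T R) (Y : {RV P >-> T1})
    (I : Type) (X : I -> {RV P >-> T2}) : Prop :=
  forall (A : set T1) (E : set T), measurable A -> family_sigma_algebra X E ->
    (P (Y @^-1` A `&` E) = P (Y @^-1` A) * P E)%E.

(* The draws are indexed from 0: [U i] stands for U_{i+1}, so that U_1, ...,
   U_N are the [U i] with [i < N w]. The symbols j keep their range j >= 1. *)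
Record poisson_urn d (T : measurableType d) (R : realType)
    (P : probability T R) (p : nat -> R) (t : R)
    (N : {RV P >-> nat}) (U : nat -> {RV P >-> nat}) : Prop := PoissonUrn {
  urn_pmf : positive_pmf p ;
  urn_draw_law : forall i j, (1 <= j)%N ->
    P (U i @^-1` [set j]) = (p j)%:E ;
  urn_draws_independent : mutually_independent U ;
  urn_size_law : forall k, P (N @^-1` [set k]) = (poisson_pmf t k)%:E ;
  urn_size_independent : independent_of_family N U }.

Section occupancy.
Context (T : Type) (R : realType) (p : nat -> R) (t : R).
Context (N : T -> nat) (U : nat -> T -> nat).
Implicit Types (j r : nat) (w : T).

Definition count_of j w : nat := (\sum_(i < N w) (U i w == j))%N.

(* Below, [fine] is harmless: for every w at most [N w] terms of the first two
   series are nonzero, and the last series is dominated by that of p. *)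
Definition distinct_symbols w : R :=
  fine (\sum_(1 <= j <oo) ((0 < count_of j w)%N%:R)%:E)%E.

Definition distinct_symbols_seen r w : R :=
  fine (\sum_(1 <= j <oo) ((count_of j w == r)%:R)%:E)%E.

Definition missing_mass w : R :=
  fine (\sum_(1 <= j <oo) (p j * (count_of j w == 0%N)%:R)%:E)%E.

Definition good_turing w : R := distinct_symbols_seen 1%N w / t.

End occupancy.

(* Main.v *)
(* Write L = ln (1 / delta) and let X_j be the number of draws of symbol j.  Then
   t (M_0 - G_0) is the sum over j of t p_j 1{X_j = 0} - 1{X_j = 1}: by Poisson
   thinning the terms are independent, and they are centred.  Bounding each
   log-Laplace transform by E e^Y - 1 and applying Chernoff's method gives, with
   v = E K and u = E (K_1 + 2 K_2), each with probability at least 1 - delta: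
     t (M_0 - G_0) <= 2 sqrt (v L) + L,    t (G_0 - M_0) <= sqrt (2 u L) + L,
     v <= K + sqrt (2 v L),                u <= K_1 + 2 K_2 + 2 sqrt (u L).
   Solving the last two for v and u and inserting them in the first two yields
   the claim. *)
Require Import Defs.
From HB Require Import structures.
From mathcomp Require Import all_boot all_order all_algebra finmap.
From mathcomp Require Import all_classical all_reals all_analysis.
From mathcomp Require Import measurable_realfun ring lra.

Set Implicit Arguments.
Unset Strict Implicit.
Unset Printing Implicit Defensive.

Import Order.TTheory GRing.Theory Num.Theory.
Import numFieldNormedType.Exports.

Local Open Scope classical_set_scope.
Local Open Scope ring_scope.

(** * Elementary exponential bounds behind the log-Laplace estimates *)

Section exponential_inequalities.
Context {R : realType}.
Implicit Types (s x m : R).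

Lemma cvg_series_exp_coeff x : series (exp_coeff x) @ \oo --> expR x.
Proof. exact: is_cvg_series_exp_coeff. Qed.

Lemma series_exp_coeff_le_expR x n :
  0 <= x -> \sum_(0 <= k < n) x ^+ k / k`!%:R <= expR x.
Proof.
move=> x0; apply: (nondecreasing_cvgn_le _ _ n).
  by apply: nondecreasing_series => k _ _; exact: exp_coeff_ge0.
exact: is_cvg_series_exp_coeff.
Qed.

(** Truncating the series of [expR s] bounds it below by 1 + s + s^2/2, and the product (1 - s +
    s^2/2) (1 + s + s^2/2) = 1 + s^4/4 is at least 1. *)
Lemma expRN_le_quadratic s : 0 <= s -> expR (- s) <= 1 - s + s ^+ 2 / 2.
Proof.
move=> s0; have := series_exp_coeff_le_expR 3 s0.
rewrite !big_nat_recr//= big_geq// expr0 expr1 !divr1 add0r => es.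
have q0 : 0 < 1 + s + s ^+ 2 / 2 by have := sqr_ge0 s; lra.
rewrite expRN; apply: (@le_trans _ _ (1 + s + s ^+ 2 / 2)^-1).
  by rewrite lef_pV2// posrE ?expR_gt0.
rewrite -[leLHS]mul1r ler_pdivrMr//.
have -> : (1 - s + s ^+ 2 / 2) * (1 + s + s ^+ 2 / 2) = 1 + s ^+ 4 / 4 by field.
by rewrite lerDl divr_ge0// exprn_ge0.
Qed.

(** Since k! >= 2 for k >= 2, the series beyond its linear part is dominated by the geometric series
    (s^2/2) (1 + s + s^2 + ...). *)
Lemma expR_le_subgamma s :
  0 <= s -> s < 1 -> expR s <= 1 + s + s ^+ 2 / (2 * (1 - s)).
Proof.
move=> s0 s1.
have s1' : 0 < 1 - s by rewrite subr_gt0.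
have -> : 1 + s + s ^+ 2 / (2 * (1 - s)) =
    ((1 - s) * (1 + s) + s ^+ 2 / 2) / (1 - s).
  by field; rewrite gt_eqF.
rewrite ler_pdivlMr// mulrC.
(* Multiplying by 1 - s telescopes the geometric series; keeping the factor 1 - s^n, instead of
   bounding it by 1, lets the induction close. *)
have bound n : (1 - s) * series (exp_coeff s) n.+2 <=
    (1 - s) * (1 + s) + s ^+ 2 / 2 * (1 - s ^+ n).
  elim: n => [|n IH].
    rewrite /series/= /exp_coeff/= !big_nat_recr//= big_geq//.
    by rewrite expr0 expr1 !divr1; lra.
  rewrite seriesSr mulrDr; apply: le_trans (lerD IH (lexx _)) _.
  have -> : (1 - s) * exp_coeff s n.+2 = (1 - s) * s ^+ n * s ^+ 2 / n.+2`!%:R.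
    by rewrite /exp_coeff/= -addn2 exprD; ring.
  have f2 : n.+2`!%:R^-1 <= 2^-1 :> R.
    rewrite lef_pV2 ?posrE ?ltr0n ?fact_gt0// ler_nat.
    by rewrite factS -[X in (X <= _)%N]muln1 leq_mul// fact_gt0.
  have c0 : 0 <= (1 - s) * s ^+ n * s ^+ 2.
    by rewrite !mulr_ge0 ?exprn_ge0// ltW.
  have := ler_wpM2l c0 f2.
  by rewrite [s ^+ n.+1]exprS; lra.
apply: (@cvgr_to_le _ \oo _ _ (fun n => (1 - s) * series (exp_coeff s) n)).
  by apply: cvgMl_tmp; exact: cvg_series_exp_coeff.
exists 2%N => //= -[|[|n]]//= _; apply: le_trans (bound n) _.
rewrite lerD2l ler_piMr ?divr_ge0 ?sqr_ge0//.
by rewrite gerBl exprn_ge0.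
Qed.

(** Coefficientwise comparison: (s m)^k <= s^2 m^k for every k >= 2, because s <= 1. *)
Lemma expRM_le_sqr s m : 0 <= s -> s <= 1 -> 0 <= m ->
  expR (s * m) - 1 - s * m <= s ^+ 2 * (expR m - 1 - m).
Proof.
move=> s0 s1 m0.
suff: s ^+ 2 * (1 + m) - (1 + s * m) <= s ^+ 2 * expR m - expR (s * m) by lra.
apply: (@cvgr_to_ge _ \oo _ _ (fun n =>
  s ^+ 2 * series (exp_coeff m) n - series (exp_coeff (s * m)) n)).
  apply: cvgB; last exact: cvg_series_exp_coeff.
  by apply: cvgMl_tmp; exact: cvg_series_exp_coeff.
exists 2%N => //= -[|[|n]]//= _; elim: n => [|n IH].
  rewrite /series/= /exp_coeff/= !big_nat_recr//= !big_geq//.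
  by rewrite !expr0 !expr1 !divr1; lra.
apply: (le_trans IH); rewrite !(seriesSr _ n.+2).
suff : exp_coeff (s * m) n.+2 <= s ^+ 2 * exp_coeff m n.+2 by lra.
rewrite /exp_coeff/= mulrA ler_wpM2r// exprMn ler_wpM2r ?exprn_ge0//.
by rewrite ler_wiXn2l.
Qed.

(** For X Poisson of mean m, the left side is E e^Y - 1 with Y = s (m 1{X = 0} - 1{X = 1}), and 1 -
    e^(-m) on the right is P(X > 0). Y is centred, so the linear terms s m and - m s cancel. *)
Lemma missing_mass_mgf_le s m : 0 <= s -> s <= 1 -> 0 <= m ->
  expR (- m) * ((expR (s * m) - 1) + m * (expR (- s) - 1)) <=
  s ^+ 2 * (1 - expR (- m)).
Proof.
move=> s0 s1 m0.
have -> : s ^+ 2 * (1 - expR (- m)) = expR (- m) * (s ^+ 2 * (expR m - 1)).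
  by rewrite [RHS]mulrCA; congr (_ * _); rewrite mulrBr mulr1 mulrC expRxMexpNx_1.
rewrite ler_wpM2l ?expR_ge0//.
have := expRM_le_sqr s0 s1 m0.
have := ler_wpM2l m0 (expRN_le_quadratic s0).
have : 0 <= m * s ^+ 2 by rewrite mulr_ge0 ?sqr_ge0.
lra.
Qed.

(** The same with Y = s (1{X = 1} - m 1{X = 0}). Here e^s has a positive exponent, whence the
    sub-gamma factor; on the right e^(-m) (m + m^2) is the variance of m 1{X = 0} - 1{X = 1}. *)
Lemma good_turing_mgf_le s m : 0 <= s -> s < 1 -> 0 <= m ->
  expR (- m) * ((expR (- (s * m)) - 1) + m * (expR s - 1)) <=
  s ^+ 2 / (2 * (1 - s)) * (expR (- m) * (m + m ^+ 2)).
Proof.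
move=> s0 s1 m0; rewrite mulrCA ler_wpM2l ?expR_ge0//.
have := expRN_le_quadratic (mulr_ge0 s0 m0).
have := ler_wpM2l m0 (expR_le_subgamma s0 s1).
have : s ^+ 2 * m ^+ 2 / 2 <= s ^+ 2 / (2 * (1 - s)) * m ^+ 2.
  rewrite mulrAC ler_wpM2r ?sqr_ge0//; apply: ler_wpM2l; first exact: sqr_ge0.
  rewrite lef_pV2 ?posrE//; lra.
rewrite exprMn; lra.
Qed.

Lemma bernoulli_mgf_le s (x : R) : 0 <= s -> 0 <= x ->
  x * (expR (- s) - 1) <= x * (- s + s ^+ 2 / 2).
Proof.
by move=> s0 x0; rewrite ler_wpM2l//; have := expRN_le_quadratic s0; lra.
Qed.

(** Here Y = - s (1{X = 1} + 2 1{X = 2}). The quadratic bound at 2 s contributes exactly (- s + s^2)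
    m^2, and at s it leaves m s^2 / 2 to spare. *)
Lemma good_turing_variance_mgf_le s m : 0 <= s -> 0 <= m ->
  expR (- m) * (m * (expR (- s) - 1) + m ^+ 2 / 2 * (expR (- (s * 2)) - 1)) <=
  (- s + s ^+ 2) * (expR (- m) * (m + m ^+ 2)).
Proof.
move=> s0 m0; rewrite mulrCA ler_wpM2l ?expR_ge0//.
have := ler_wpM2l m0 (expRN_le_quadratic s0).
have m2 : 0 <= m ^+ 2 / 2 by rewrite divr_ge0 ?sqr_ge0.
have := ler_wpM2l m2 (@expRN_le_quadratic (s * 2) (mulr_ge0 s0 (ler0n _ 2))).
have : 0 <= m * s ^+ 2 by rewrite mulr_ge0 ?sqr_ge0.
rewrite exprMn; lra.
Qed.

End exponential_inequalities.

(** * Multinomial means as coefficients of exponential generating functions *)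

Section poissonization.
Context {R : realType}.
Implicit Types (q : nat -> R) (g : nat -> nat -> R).

(** Absorbs a draw of outcome [i] into the test functions, so that conditioning on a draw again
    leaves a product of functions of the counts. *)
Definition bump_at i g : nat -> nat -> R := fun j k => g j (k + (j == i))%N.

(* The expectation of [\prod_(j < J) g j X_j] when X counts the outcomes of m
   draws with weights [q 0, ..., q J.-1], computed by conditioning on one draw. *)
Fixpoint multinomial_mean (J : nat) q (m : nat) g : R :=
  if m is m'.+1 then \sum_(i < J) q i * multinomial_mean J q m' (bump_at i g)
  else \prod_(j < J) g j 0%N.

(* The coefficient of z^m in [\prod_(j < J) \sum_k (q j * z)^k / k! * g j k]. *)
Fixpoint egf_coef (J : nat) q g (m : nat) : R :=
  if J is J'.+1 then
    \sum_(k < m.+1) (q J' ^+ k / k`!%:R * g J' k) * egf_coef J' q g (m - k)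
  else (m == 0%N)%:R.

Lemma eq_egf_coef J q g g' m : (forall j, (j < J)%N -> g j =1 g' j) ->
  egf_coef J q g m = egf_coef J q g' m.
Proof.
elim: J m => [//|J IH] m gg' /=; apply: eq_bigr => k _.
by rewrite gg'// IH// => j jJ; apply: gg'; rewrite ltnW.
Qed.

(* Differentiation of the generating function, coefficientwise. *)
Lemma egf_coefS J q g m : m.+1%:R * egf_coef J q g m.+1 =
  \sum_(i < J) q i * egf_coef J q (bump_at i g) m.
Proof.
elim: J m => [|J IH] m; first by rewrite /= big_ord0 mulr0.
pose a g k := q J ^+ k / k`!%:R * g J k : R.
rewrite [RHS]big_ord_recr.
have -> : \sum_(i < J) q i * egf_coef J.+1 q (bump_at i g) m =
    \sum_(k < m.+1) a g k * ((m - k).+1%:R * egf_coef J q g (m - k).+1).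
  rewrite /= (eq_bigr (fun i : 'I_J => \sum_(k < m.+1)
      a g k * (q i * egf_coef J q (bump_at i g) (m - k)))); last first.
    move=> i _; rewrite mulr_sumr; apply: eq_bigr => k _.
    by rewrite /a /bump_at gtn_eqF// addn0; ring.
  rewrite exchange_big/=; apply: eq_bigr => k _.
  by rewrite -mulr_sumr IH.
(* Differentiating the factor of index [J] shifts its coefficients by one. *)
have -> : q J * egf_coef J.+1 q (bump_at J g) m =
    \sum_(k < m.+1) (k.+1%:R * a g k.+1) * egf_coef J q g (m - k).
  rewrite /= mulr_sumr; apply: eq_bigr => k _; rewrite mulrA; congr (_ * _).
    rewrite /a /bump_at eqxx addn1 exprS factS natrM.
    by field; rewrite nat1r !pnatr_eq0 -lt0n fact_gt0.
  by apply: eq_egf_coef => j jJ k'; rewrite /bump_at ltn_eqF// addn0.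
(* Leibniz rule: m + 1 = k + (m + 1 - k), and each part differentiates one of the two factors. *)
have -> : m.+1%:R * egf_coef J.+1 q g m.+1 =
    \sum_(k < m.+2) (k%:R * a g k) * egf_coef J q g (m.+1 - k) +
    \sum_(k < m.+2) a g k * ((m.+1 - k)%:R * egf_coef J q g (m.+1 - k)).
  rewrite -big_split/= mulr_sumr; apply: eq_bigr => k _.
  rewrite -/(a g k).
  have -> : m.+1%:R = k%:R + (m.+1 - k)%:R :> R by rewrite -natrD subnKC// -ltnS.
  by ring.
rewrite addrC; congr (_ + _).
  rewrite big_ord_recr/= subnn mul0r mulr0 addr0; apply: eq_bigr => k _.
  by rewrite subSn// -ltnS.
by rewrite big_ord_recl/= !mul0r add0r; apply: eq_bigr => k _; rewrite subSS.
Qed.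

(** By [egf_coefS], both sides obey the same recursion in m. *)
Lemma multinomial_mean_egf J q g m :
  multinomial_mean J q m g = m`!%:R * egf_coef J q g m.
Proof.
elim: m g => [|m IH] g /=.
  rewrite mul1r; elim: J => [|J IH]/=; first by rewrite big_ord0.
  by rewrite big_ord_recr/= IH big_ord1 expr0 divr1 mul1r subnn mulrC.
rewrite factS mulnC natrM -mulrA egf_coefS mulr_sumr; apply: eq_bigr => i _.
by rewrite IH; ring.
Qed.

(** Substitution of c z for z; it absorbs the power t^n of the Poisson weight. *)
Lemma egf_coefZ J q g c m :
  egf_coef J (fun j => c * q j) g m = c ^+ m * egf_coef J q g m.
Proof.
elim: J m => [|J IH] m /=; first by case: m => [|m]; rewrite ?mulr0 ?mulr1.
rewrite mulr_sumr; apply: eq_bigr => k _.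
by rewrite IH -[in c ^+ m](@subnKC k m) -1?ltnS// exprD exprMn; ring.
Qed.

Lemma egf_coef_ge0 J q g m : (forall j, 0 <= q j) -> (forall j k, 0 <= g j k) ->
  0 <= egf_coef J q g m.
Proof.
move=> q0 g0; elim: J m => [|J IH] m /=; first exact: ler0n.
by apply: sumr_ge0 => k _; rewrite !mulr_ge0// exprn_ge0.
Qed.

(** Expanding the product of truncated series yields every term of total degree below M, together
    with others that are nonnegative. *)
Lemma sum_egf_coef_le J q g M : (forall j, 0 <= q j) -> (forall j k, 0 <= g j k) ->
  \sum_(m < M) egf_coef J q g m <=
  \prod_(j < J) \sum_(k < M) q j ^+ k / k`!%:R * g j k.
Proof.
move=> q0 g0; elim: J => [|J IH].
  rewrite big_ord0; case: M => [|M]; first by rewrite big_ord0.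
  by rewrite big_ord_recl/= big1 ?addr0.
have a0 k : 0 <= q J ^+ k / k`!%:R * g J k by rewrite !mulr_ge0// exprn_ge0.
rewrite big_ord_recr/= mulrC.
apply: (@le_trans _ _ ((\sum_(k < M) q J ^+ k / k`!%:R * g J k) *
    \sum_(m < M) egf_coef J q g m)); last by rewrite ler_wpM2l// sumr_ge0.
rewrite mulr_suml.
rewrite (eq_bigr (fun m : 'I_M => \sum_(k < M | (k <= m)%N)
    (q J ^+ k / k`!%:R * g J k) * egf_coef J q g (m - k))); last first.
  move=> m _; rewrite (big_ord_widen_cond M (fun=> true) (fun k : nat =>
    (q J ^+ k / k`!%:R * g J k) * egf_coef J q g (m - k)))//.
rewrite (exchange_big_dep xpredT)//=; apply: ler_sum => k _.
rewrite -mulr_sumr ler_wpM2l//.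
rewrite -(big_mkord (fun m => (k <= m)%N) (fun m => egf_coef J q g (m - k))).
rewrite -(big_mkord xpredT (fun m => egf_coef J q g m)).
(* The indices m < k contribute nothing; shifting the rest by k leaves M - k coefficients, at most
   the sum of all M of them. *)
rewrite (@big_cat_nat _ _ _ k)//= ?(ltnW (ltn_ord k))//.
rewrite big_nat_cond big1 ?add0r; last first.
  by move=> i /andP[/andP[_ ik]]; rewrite leqNgt ik.
rewrite -{1}[val k]add0n big_addn big_mkcond/=.
rewrite [leRHS](@big_cat_nat _ _ _ (M - k)%N)//= ?leq_subr//.
rewrite -[leLHS]addr0 lerD//; last by rewrite sumr_ge0// => i _; exact: egf_coef_ge0.
by apply: ler_sum => i _; rewrite addnK leq_addl.
Qed.

End poissonization.

(** * Choice of the Chernoff parameter and solution of the quadratic inequalities *)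

Section chernoff_optimization.
Context {R : realType}.
Implicit Types (v L D : R).

(* When v < L the unconstrained optimum sqrt (L / v) exceeds 1, but s = 1 then
   already gives v + L <= 2 * sqrt (v * L) + L. *)
Lemma chernoff_opt_missing_mass v L : 0 < v -> 0 < L ->
  exists2 s, 0 < s <= 1 &
    forall D, s * D < s ^+ 2 * v + L -> D <= 2 * Num.sqrt (v * L) + L.
Proof.
move=> v0 L0; rewrite sqrtrM ?ltW//.
have a0 : 0 < Num.sqrt v by rewrite sqrtr_gt0.
have b0 : 0 < Num.sqrt L by rewrite sqrtr_gt0.
have av := sqr_sqrtr (ltW v0); have bL := sqr_sqrtr (ltW L0).
set a := Num.sqrt v in a0 av *; set b := Num.sqrt L in b0 bL *.
have [Lv|vL] := leP L v; last first.
  exists 1; first by rewrite ltr01 lexx.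
  move=> D; rewrite mul1r expr1n mul1r => /ltW /le_trans; apply.
  rewrite lerD2r; have ab : a <= b by rewrite ler_sqrt// ltW.
  rewrite -av; nra.
exists (b / a).
  by rewrite divr_gt0//= ler_pdivrMr// mul1r ler_sqrt// ltW.
move=> D; have -> : (b / a) ^+ 2 * v = L by rewrite -av -bL; field; rewrite gt_eqF.
rewrite mulrAC ltr_pdivrMr// -bL => H.
have : D < 2 * a * b by rewrite -(ltr_pM2l b0); move: H; nra.
by move=> /ltW /le_trans; apply; rewrite mulrA lerDl sqr_ge0.
Qed.

(** The parameter must be fixed before the sample, so one [s] serves every [D]. Dividing by s gives
    v - D < v s / 2 + L / s, which is least at s = sqrt (2 L / v). *)
Lemma chernoff_opt_gaussian_lower v L : 0 < v -> 0 < L ->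
  exists2 s, 0 < s &
    forall D, - (s * D) < v * (- s + s ^+ 2 / 2) + L -> v <= D + Num.sqrt (2 * v * L).
Proof.
move=> v0 L0; rewrite -mulrA mulrCA sqrtrM ?ltW//.
have L20 : 0 < 2 * L by rewrite mulr_gt0.
have a0 : 0 < Num.sqrt v by rewrite sqrtr_gt0.
have b0 : 0 < Num.sqrt (2 * L) by rewrite sqrtr_gt0.
have av := sqr_sqrtr (ltW v0); have bL := sqr_sqrtr (ltW L20).
set a := Num.sqrt v in a0 av *; set b := Num.sqrt (2 * L) in b0 bL *.
exists (b / a); first exact: divr_gt0.
move=> D H; apply: ltW; rewrite -(ltr_pM2l (divr_gt0 b0 a0)).
have E1 : v * (- (b / a) + (b / a) ^+ 2 / 2) = - (b / a * v) + L.
  have -> : L = b ^+ 2 / 2 by rewrite bL; field.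
  by rewrite -av; field; rewrite gt_eqF.
have E2 : b / a * (D + a * b) = b / a * D + 2 * L.
  by rewrite -bL; field; rewrite gt_eqF.
by rewrite E2; move: H; rewrite E1; lra.
Qed.

(** Minimising s v / (2 (1 - s)) + L / s gives s / (1 - s) = sqrt (2 L / v), that is s = b / (a + b)
    with a = sqrt v and b = sqrt (2 L); this is automatically below 1. *)
Lemma chernoff_opt_subgamma v L : 0 < v -> 0 < L ->
  exists2 s, 0 < s < 1 &
    forall D, s * D < s ^+ 2 / (2 * (1 - s)) * v + L ->
      D <= Num.sqrt (2 * v * L) + L.
Proof.
move=> v0 L0; rewrite -mulrA mulrCA sqrtrM ?ltW//.
have L20 : 0 < 2 * L by rewrite mulr_gt0.
have a0 : 0 < Num.sqrt v by rewrite sqrtr_gt0.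
have b0 : 0 < Num.sqrt (2 * L) by rewrite sqrtr_gt0.
have av := sqr_sqrtr (ltW v0); have bL := sqr_sqrtr (ltW L20).
set a := Num.sqrt v in a0 av *; set b := Num.sqrt (2 * L) in b0 bL *.
have ab0 : 0 < a + b by rewrite addr_gt0.
have s0 : 0 < b / (a + b) by rewrite divr_gt0.
have LE : L = b ^+ 2 / 2 by rewrite bL; field.
exists (b / (a + b)).
  by rewrite s0/= ltr_pdivrMr// mul1r ltrDr.
move=> D H; apply: ltW; rewrite -(ltr_pM2l s0); apply: (lt_le_trans H).
rewrite le_eqVlt; apply/orP; left; apply/eqP.
have -> : 1 - b / (a + b) = a / (a + b) by field; rewrite gt_eqF.
by rewrite LE -av; field; rewrite !gt_eqF.
Qed.

(** Dividing by s gives v - D < v s + L / s, least at s = sqrt (L / v). *)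
Lemma chernoff_opt_subgaussian_lower v L : 0 < v -> 0 < L ->
  exists2 s, 0 < s &
    forall D, - (s * D) < (- s + s ^+ 2) * v + L -> v <= D + 2 * Num.sqrt (v * L).
Proof.
move=> v0 L0; rewrite sqrtrM ?ltW//.
have a0 : 0 < Num.sqrt v by rewrite sqrtr_gt0.
have b0 : 0 < Num.sqrt L by rewrite sqrtr_gt0.
have av := sqr_sqrtr (ltW v0); have bL := sqr_sqrtr (ltW L0).
set a := Num.sqrt v in a0 av *; set b := Num.sqrt L in b0 bL *.
exists (b / a); first exact: divr_gt0.
move=> D H; apply: ltW; rewrite -(ltr_pM2l (divr_gt0 b0 a0)).
have E1 : (- (b / a) + (b / a) ^+ 2) * v = - (b / a * v) + L.
  by rewrite -bL -av; field; rewrite gt_eqF.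
have E2 : b / a * (D + 2 * (a * b)) = b / a * D + 2 * L.
  by rewrite -bL; field; rewrite gt_eqF.
by rewrite E2; move: H; rewrite E1; lra.
Qed.

(** Multiplied by L, the hypothesis becomes a quadratic inequality in x = sqrt (v L), which forces x
    <= z / 2 + 2 L for z = sqrt (6 K L). *)
Lemma deviation_plugin_upper v K L : 0 <= v -> 0 <= K -> 0 < L ->
  v <= K + Num.sqrt (2 * v * L) ->
  2 * Num.sqrt (v * L) + L <= Num.sqrt (6 * K * L) + 5 * L.
Proof.
move=> v0 K0 L0 vK; have L0' := ltW L0.
have x0 := sqrtr_ge0 (v * L); have xE := sqr_sqrtr (mulr_ge0 v0 L0').
have z0 := sqrtr_ge0 (6 * K * L).
have zE : Num.sqrt (6 * K * L) ^+ 2 = 6 * K * L by rewrite sqr_sqrtr// !mulr_ge0.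
have r0 := sqrtr_ge0 (2 * v * L).
have rE : Num.sqrt (2 * v * L) ^+ 2 = 2 * v * L by rewrite sqr_sqrtr// !mulr_ge0.
move: x0 xE z0 zE r0 rE vK.
set x := Num.sqrt (v * L); set z := Num.sqrt (6 * K * L).
set r := Num.sqrt (2 * v * L) => x0 xE z0 zE r0 rE vK.
(* A rational bound for sqrt 2, which keeps the rest polynomial. *)
have rx : r <= 3 / 2 * x.
  rewrite -(@ler_pXn2r _ 2%N)// ?nnegrE ?mulr_ge0 ?divr_ge0//.
  by rewrite rE exprMn xE; have := mulr_ge0 v0 L0'; lra.
have x2 : x ^+ 2 <= z ^+ 2 / 6 + 3 / 2 * x * L.
  have := ler_wpM2r L0' vK; have := ler_wpM2r L0' rx; rewrite xE zE; lra.
rewrite leNgt; apply/negP => lt.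
(* Put c = z / 2 + 2 L, so that c - 3 L / 2 = z / 2 + L / 2. If x > c, the two products add up to
   x^2 - 3 x L / 2 > c (c - 3 L / 2) >= z^2 / 6, against [x2]. *)
have p1 : 0 < (x - (z / 2 + 2 * L)) * x by rewrite mulr_gt0//; lra.
have p2 : 0 <= (x - (z / 2 + 2 * L)) * (z / 2 + L / 2) by rewrite mulr_ge0//; lra.
have zL : 0 <= z * L by rewrite mulr_ge0.
have zz := sqr_ge0 z; have LL := sqr_ge0 L.
nra.
Qed.

Lemma deviation_plugin_lower w W L : 0 <= w -> 0 <= W -> 0 < L ->
  w <= W + 2 * Num.sqrt (w * L) ->
  Num.sqrt (2 * w * L) + L <= Num.sqrt (2 * W * L) + 4 * L.
Proof.
move=> w0 W0 L0 wW; have L0' := ltW L0.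
have x0 := sqrtr_ge0 (w * L); have xE := sqr_sqrtr (mulr_ge0 w0 L0').
have z0 := sqrtr_ge0 (2 * W * L).
have zE : Num.sqrt (2 * W * L) ^+ 2 = 2 * W * L by rewrite sqr_sqrtr// !mulr_ge0.
have r0 := sqrtr_ge0 (2 * w * L).
have rE : Num.sqrt (2 * w * L) ^+ 2 = 2 * w * L by rewrite sqr_sqrtr// !mulr_ge0.
move: x0 xE z0 zE r0 rE wW.
set x := Num.sqrt (w * L); set z := Num.sqrt (2 * W * L).
set r := Num.sqrt (2 * w * L) => x0 xE z0 zE r0 rE wW.
(* 71/100 lies just above 1 / sqrt 2; the 284/100 below is four times it. *)
have xr : x <= 71 / 100 * r.
  rewrite -(@ler_pXn2r _ 2%N)// ?nnegrE ?mulr_ge0 ?divr_ge0//.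
  by rewrite xE exprMn rE; have := mulr_ge0 w0 L0'; lra.
have r2 : r ^+ 2 <= z ^+ 2 + 284 / 100 * r * L.
  have := ler_wpM2r L0' wW; have := ler_wpM2r L0' xr; rewrite rE zE; lra.
rewrite leNgt; apply/negP => lt.
(* As in the upper bound, now with c = z + 3 L and c - 284/100 L = z + 16/100 L, so that c (c -
   284/100 L) >= z^2. *)
have p1 : 0 < (r - (z + 3 * L)) * r by rewrite mulr_gt0//; lra.
have p2 : 0 <= (r - (z + 3 * L)) * (z + 16 / 100 * L) by rewrite mulr_ge0//; lra.
have zL : 0 <= z * L by rewrite mulr_ge0.
have zz := sqr_ge0 z; have LL := sqr_ge0 L.
nra.
Qed.

End chernoff_optimization.

(** * Joint law of the counts, Poisson thinning and the Chernoff bound *)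

Section joint_law.
Context (R : realType) (d : measure_display) (T : measurableType d).
Context (P : probability T R) (p : nat -> R) (t : R).
Context (N : {RV P >-> nat}) (U : nat -> {RV P >-> nat}).
Hypotheses (t_gt0 : 0 < t) (urn : poisson_urn p t N U).

Lemma measurable_RV_preimage (X : {RV P >-> nat}) (A : set nat) :
  measurable (X @^-1` A).
Proof. exact: (measurable_funPTI X). Qed.

Lemma urn_joint_law n (B : nat -> set nat) :
  P [set w | N w = n /\ forall i, (i < n)%N -> B i (U i w)] =
  ((poisson_pmf t n)%:E * \prod_(i < n) P (U i @^-1` B i))%E.
Proof.
pose J := seq_fset tt (iota 0 n).
have -> : [set w | N w = n /\ forall i, (i < n)%N -> B i (U i w)] =
    N @^-1` [set n] `&` \bigcap_(i in [set` J]) U i @^-1` B i.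
  apply/seteqP; split=> w /= [Nn UB]; split=> // i.
    by rewrite /= seq_fsetE mem_iota => /UB.
  by move=> ni; apply: UB; rewrite /= seq_fsetE mem_iota.
rewrite (urn_size_independent urn)//; last first.
  (* Independence from [N] is stated for the sigma-algebra generated by the draws, so the
     intersection must be measurable for that one. *)
  suff : @measurable _ (g_sigma_algebraType
      (\bigcup_i preimage_set_system [set: T] (U i) measurable))
      (\bigcap_(i in [set` J]) U i @^-1` B i) by [].
  apply: fin_bigcap_measurable => // i _; apply: sub_sigma_algebra.
  by exists i => //; exists (B i) => //; rewrite setTI.
rewrite (urn_draws_independent urn)// (urn_size_law urn); congr (_ * _)%E.
rewrite (perm_big _ (seq_fset_perm _ _))/= undup_id ?iota_uniq//.
by rewrite -(big_mkord xpredT (fun i => P (U i @^-1` B i))) /index_iota subn0.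
Qed.

(* Symbols above J, and the null symbol 0, are merged into category 0. *)
Definition category J u : nat := if (0 < u <= J)%N then u else 0%N.

(** The draw law is given at positive symbols only, so category 0 receives the complementary
    mass. *)
Definition category_weight J i : R :=
  if i == 0%N then 1 - \sum_(1 <= j < J.+1) p j else p i.

Lemma category_le J u : (category J u <= J)%N.
Proof. by rewrite /category; case: ifP => // /andP[]. Qed.

Lemma category_eq J u j : (0 < j <= J)%N -> (category J u == j) = (u == j).
Proof.
move=> jJ; rewrite /category; case: ifPn => // uJ.
case: eqP jJ => [<-//|_ jJ]; apply/esym/negbTE.
by apply: contraNneq uJ => ->.
Qed.

Lemma category_law J i c : (c <= J)%N ->
  P (U i @^-1` [set u | category J u = c]) = (category_weight J c)%:E.
Proof.
rewrite /category_weight; case: (posnP c) => [->|c0] cJ; last first.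
  rewrite -(urn_draw_law urn i c0); congr (P _).
  apply/seteqP; split=> w /=; rewrite /category.
    by case: ifP => // _ c0'; rewrite -c0' in c0.
  by move=> ->; rewrite c0 cJ.
have -> : U i @^-1` [set u | category J u = 0%N] =
    ~` (\big[setU/set0]_(k < J) (U i @^-1` [set k.+1])).
  rewrite -[LHS]setCK; congr (~` _).
  rewrite -(bigcup_mkord J (fun k => U i @^-1` [set k.+1])).
  apply/seteqP; split=> w /=; rewrite /category.
    case: ifP => // /andP[u0 uJ] _; exists (U i w).-1; last by rewrite /= prednK.
    by rewrite /= prednK.
  by move=> [k /= kJ ->]; rewrite kJ.
rewrite probability_setC; last first.
  by apply: bigsetU_measurable => k _; exact: measurable_RV_preimage.
rewrite (@measure_bigsetU _ _ _ P (fun k => U i @^-1` [set k.+1])); first last.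
- apply/trivIsetP => a b _ _ ab; rewrite -subset0 => w /= [-> [ba]].
  by rewrite ba eqxx in ab.
- by move=> k; exact: measurable_RV_preimage.
rewrite (eq_bigr (fun k : 'I_J => (p k.+1)%:E)); last first.
  by move=> k _; exact: (urn_draw_law urn i (isT : (1 <= k.+1)%N)).
by rewrite sumEFin -EFinB big_add1/= big_mkord.
Qed.

Lemma category_weight_ge0 J c : (c <= J)%N -> 0 <= category_weight J c.
Proof. by move=> cJ; rewrite -lee_fin -(category_law 0 cJ) measure_ge0. Qed.

Lemma sum_category_weight J : \sum_(c < J.+1) category_weight J c = 1.
Proof.
rewrite big_ord_recl /category_weight/= big_add1 big_mkord/=.
by rewrite subrK.
Qed.

Definition last_draws_event J n m (b : nat -> nat) : set T :=
  [set w | N w = n /\ forall i, (m <= i < n)%N -> category J (U i w) = b i].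

Lemma measurable_last_draws_event J n m b : measurable (last_draws_event J n m b).
Proof.
have -> : last_draws_event J n m b = N @^-1` [set n] `&`
    \bigcap_(i in [set i | (m <= i < n)%N]) (U i @^-1` [set u | category J u = b i]).
  by apply/seteqP; split=> w /= [Nn H]; split.
apply: measurableI; first exact: measurable_RV_preimage.
by apply: bigcap_measurableType => i _; exact: measurable_RV_preimage.
Qed.

Lemma last_draws_event0 J n b : (forall i, (b i <= J)%N) ->
  P (last_draws_event J n 0 b) =
  (poisson_pmf t n * \prod_(i < n) category_weight J (b i))%:E.
Proof.
move=> bJ; rewrite [LHS](urn_joint_law n (fun i => [set u | category J u = b i])).
rewrite EFinM; congr (_ * _)%E.
by rewrite -prodEFin; apply: eq_bigr => i _; rewrite category_law.
Qed.

Definition category_count J m j w : nat := (\sum_(i < m) (category J (U i w) == j))%N.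

Lemma measurable_category_count J m j :
  measurable_fun [set: T] (category_count J m j).
Proof.
elim: m => [|m IH].
  rewrite (_ : category_count J 0 j = cst 0%N)//.
  by apply/funext => w; rewrite /category_count big_ord0.
rewrite (_ : category_count J m.+1 j = fun w =>
    (category_count J m j w + (category J (U m w) == j))%N); last first.
  by apply/funext => w; rewrite /category_count big_ord_recr.
apply: measurable_fun_addn => //.
exact: (measurableT_comp (f := fun u => nat_of_bool (category J u == j))).
Qed.

Lemma count_ofE J j w : (0 < j <= J)%N ->
  count_of N U j w = category_count J (N w) j w.
Proof. by move=> jJ; apply: eq_bigr => i _; rewrite category_eq. Qed.

Lemma measurable_count_of j : (0 < j)%N -> measurable_fun [set: T] (count_of N U j).
Proof.
move=> j0 _ A mA; rewrite setTI.
(* On each event N = n the count is a finite sum, and truncation at level [j] already keeps the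
   symbol [j] separate. *)
have -> : count_of N U j @^-1` A =
    \bigcup_n (N @^-1` [set n] `&` category_count j n j @^-1` A).
  apply/seteqP; split=> w /=.
    by move=> Aw; exists (N w) => //; split=> //=; rewrite -count_ofE ?j0 ?leqnn.
  by move=> [n _ [/= <-]]; rewrite -count_ofE ?j0 ?leqnn.
apply: bigcupT_measurable => n; apply: measurableI.
  exact: measurable_RV_preimage.
by rewrite -[X in measurable X]setTI; exact: measurable_category_count.
Qed.

(* Freezing the categories of the draws m, ..., n.-1 gives an induction on m that
   peels off one draw at a time. *)
Lemma integral_last_draws J n m b (g : nat -> nat -> R) :
  (m <= n)%N -> (forall i, (b i <= J)%N) ->
  (forall j k, 0 <= g j k) ->
  (\int[P]_(w in last_draws_event J n m b)
    (\prod_(j < J.+1) g j (category_count J m j w))%:E =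
  (poisson_pmf t n * \prod_(m <= i < n) category_weight J (b i) *
   multinomial_mean J.+1 (category_weight J) m g)%:E)%E.
Proof.
elim: m g b => [|m IH] g b mn bJ g0.
  rewrite (eq_integral (cst (\prod_(j < J.+1) g j 0%N)%:E)); last first.
    by move=> w _; rewrite /category_count; under eq_bigr do rewrite big_ord0.
  rewrite integral_cst; last exact: measurable_last_draws_event.
  rewrite [X in (_ * X)%E](last_draws_event0 n bJ).
  by rewrite -EFinM mulrC big_mkord.
(* Also freezes draw m, to category c; the event splits disjointly over c. *)
pose b' c := fun i => if i == m then c else b i.
have b'J (c : 'I_J.+1) i : (b' c i <= J)%N.
  by rewrite /b'; case: ifP => // _; rewrite -ltnS.
have eventE : last_draws_event J n m.+1 b =
    \big[setU/set0]_(c <- index_enum 'I_J.+1) last_draws_event J n m (b' c).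
  rewrite -bigcup_seq; apply/seteqP; split=> w /=.
    move=> [Nn H]; exists (inord (category J (U m w))); first by rewrite /= mem_index_enum.
    split=> // i /andP[mi ni]; rewrite /b'; case: eqP => [->|/eqP im].
      by rewrite inordK// ltnS category_le.
    by apply: H; rewrite ni andbT ltn_neqAle eq_sym im.
  move=> [c _ [Nn H]]; split=> // i /andP[mi ni].
  by rewrite H ?ni ?(ltnW mi)// /b' gtn_eqF.
rewrite eventE ge0_integral_bigsetU//=; last 5 first.
- by move=> c; exact: measurable_last_draws_event.
- exact: index_enum_uniq.
- apply/trivIsetP => c1 c2 _ _ c12; rewrite -subset0 => w /= [[_ H1] [_ H2]].
  have mm : (m <= m < n)%N by rewrite leqnn.
  have := H1 _ mm; rewrite (H2 _ mm) /b' eqxx => /val_inj c21.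
  by rewrite c21 eqxx in c12.
- apply/measurable_EFinP/measurable_funTS; apply: measurable_prod => j _.
  exact: (measurableT_comp (f := g j)) (measurable_category_count _ _ _).
- by move=> w _; rewrite lee_fin prodr_ge0.
rewrite mulr_sumr -sumEFin; apply: eq_bigr => c _.
(* Draw m is now known to lie in category c, so its contribution to the counts moves into the test
   functions. *)
rewrite (eq_integral (fun w =>
    (\prod_(j < J.+1) bump_at c g j (category_count J m j w))%:E)); last first.
  move=> w /set_mem[_ H]; congr (_%:E); apply: eq_bigr => j _.
  rewrite /bump_at /category_count big_ord_recr/= H ?leqnn// /b' eqxx.
  by rewrite eq_sym.
rewrite IH//; [|exact: ltnW|by move=> j k; exact: g0].
congr (_%:E); rewrite (big_ltn mn) /b' eqxx.
have -> : \prod_(m.+1 <= i < n) category_weight J (if i == m then c : nat else b i) =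
    \prod_(m.+1 <= i < n) category_weight J (b i).
  by apply: eq_big_nat => i /andP[mi _]; rewrite gtn_eqF.
by ring.
Qed.

(** Poisson thinning as an inequality: summing over N = n the Poisson weight times the multinomial
    mean gives e^(-t) times a sum of generating function coefficients, which is at most a product of
    series, one per category. The hypothesis reads E g_j(X_j) <= e_j in terms of partial sums. *)
Lemma integral_prod_count_of_le J (g : nat -> nat -> R) (e : nat -> R) :
  (forall j k, 0 <= g j k) ->
  (forall j M, (0 < j)%N ->
    \sum_(k < M) (t * p j) ^+ k / k`!%:R * g j k <= expR (t * p j) * e j) ->
  (\int[P]_w (\prod_(1 <= j < J.+1) g j (count_of N U j w))%:E <=
   (\prod_(1 <= j < J.+1) e j)%:E)%E.
Proof.
move=> g0 ge.
(* The merged category 0 carries no test function. *)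
pose g' j k : R := if j == 0%N then 1 else g j k.
have g'0 j k : 0 <= g' j k by rewrite /g'; case: ifP.
pose q := category_weight J.
have q0 j : 0 <= q j.
  rewrite /q; case: (leqP j J) => [|Jj]; first exact: category_weight_ge0.
  rewrite /category_weight gtn_eqF ?(leq_ltn_trans _ Jj)//.
  by apply: (urn_pmf urn).1; rewrite (leq_ltn_trans _ Jj).
have tq0 j : 0 <= t * q j by rewrite mulr_ge0// ltW.
have mF D : measurable_fun D
    (fun w => (\prod_(1 <= j < J.+1) g j (count_of N U j w))%:E).
  apply/measurable_EFinP/measurable_funTS; apply: measurable_prod => j.
  rewrite mem_index_iota => /andP[j0 _].
  exact: (measurableT_comp (f := g j)) (measurable_count_of j0).
have -> : [set: T] = \bigcup_n N @^-1` [set n].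
  by apply/seteqP; split=> w _ //; exists (N w).
rewrite ge0_integral_bigcup//; last 3 first.
- by move=> n; exact: measurable_RV_preimage.
- by move=> w _; rewrite lee_fin prodr_ge0.
- apply/trivIsetP => n1 n2 _ _ n12; rewrite -subset0 => w /= [-> n21].
  by rewrite n21 eqxx in n12.
have termE n : (\int[P]_(w in N @^-1` [set n])
    (\prod_(1 <= j < J.+1) g j (count_of N U j w))%:E =
    (expR (- t) * egf_coef J.+1 (fun j => t * q j) g' n)%:E)%E.
  (* With m = n no draw is frozen, so the values chosen for them are immaterial. *)
  have -> : N @^-1` [set n] = last_draws_event J n n (fun=> 0%N).
    apply/seteqP; split=> w /=; last by case.
    by move=> Nn; split=> // i; rewrite ltnNge; case: (n <= i)%N.
  rewrite (eq_integral (fun w =>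
    (\prod_(j < J.+1) g' j (category_count J n j w))%:E)); last first.
    move=> w /set_mem[Nn _]; congr (_%:E).
    rewrite big_ord_recl/= /g'/= mul1r big_add1/= big_mkord.
    apply: eq_bigr => j _; congr (g _ _).
    by rewrite (@count_ofE J) ?Nn//= ltn_ord.
  (* In e^(-t) t^n / n! the factorial cancels against the multinomial one and t^n is absorbed into
     the weights. *)
  rewrite integral_last_draws// big_geq// mulr1 multinomial_mean_egf.
  rewrite egf_coefZ /poisson_pmf t_gt0; congr (_%:E).
  by field; rewrite pnatr_eq0 -lt0n fact_gt0.
under eq_eseriesr do rewrite termE.
apply: lime_le.
  apply: is_cvg_nneseries => n _ _; rewrite lee_fin mulr_ge0 ?expR_ge0//.
  exact: egf_coef_ge0.
apply: nearW => M; rewrite big_mkord sumEFin lee_fin -mulr_sumr.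
have := @sum_egf_coef_le _ J.+1 _ _ M tq0 g'0.
rewrite [X in _ <= X]big_ord_recl/= => H.
apply: (@le_trans _ _ (expR (- t) * (expR (t * q 0%N) *
    \prod_(j < J) (expR (t * q j.+1) * e j.+1)))).
  rewrite ler_wpM2l ?expR_ge0//; apply: (le_trans H).
  apply: ler_pM.
  - by apply: sumr_ge0 => k _; rewrite !mulr_ge0// exprn_ge0.
  - by apply: prodr_ge0 => j _; apply: sumr_ge0 => k _; rewrite !mulr_ge0// exprn_ge0.
  - under eq_bigr do rewrite /g'/= mulr1.
    rewrite -(big_mkord xpredT (fun k => (t * q 0%N) ^+ k / k`!%:R)).
    exact: series_exp_coeff_le_expR.
  - apply: ler_prod => j _; apply/andP; split.
      by apply: sumr_ge0 => k _; rewrite !mulr_ge0// exprn_ge0.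
    rewrite /q /category_weight/=; apply: ge => //.
rewrite big_split/= -expR_sum mulrA mulrA -!expRD big_add1/= big_mkord.
rewrite -addrA -mulr_sumr -mulrDr.
(* All category weights sum to 1, so the exponentials multiply to e^t and cancel e^(-t). *)
have -> : q 0%N + \sum_(j < J) q j.+1 = 1.
  by rewrite -(sum_category_weight J) big_ord_recl.
by rewrite mulr1 addNr expR0 mul1r.
Qed.
Lemma measurable_occupancy_sum (f : nat -> nat -> R) n :
  measurable_fun [set: T] (fun w => \sum_(1 <= j < n) f j (count_of N U j w)).
Proof.
under eq_fun do rewrite big_add1/=.
apply: measurable_sum => j.
exact: (measurableT_comp (f := f j.+1)) (measurable_count_of _).
Qed.

Lemma measurable_occupancy_limit (f : nat -> nat -> R) (S : T -> R) :
  (forall w, (\sum_(1 <= j < n) f j (count_of N U j w)) @[n --> \oo] --> S w) ->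
  measurable_fun [set: T] S.
Proof.
move=> fS; apply: (measurable_fun_cvg (measurable_occupancy_sum f)) => w _.
exact: fS.
Qed.

(** The first hypothesis says E exp (f_j(X_j)) <= exp B_j. Thinning bounds the exponential moment of
    each finite sum, Fatou passes to the limit, and Markov's inequality concludes. *)
Lemma chernoff_occupancy (f : nat -> nat -> R) (S : T -> R) (B : nat -> R) b L :
  (forall j M, (0 < j)%N ->
    \sum_(k < M) (t * p j) ^+ k / k`!%:R * expR (f j k) <=
    expR (t * p j) * expR (B j)) ->
  (forall w, (\sum_(1 <= j < n) f j (count_of N U j w)) @[n --> \oo] --> S w) ->
  (\sum_(1 <= j < n) B j) @[n --> \oo] --> b ->
  measurable [set w | b + L <= S w] /\
  (P [set w | (b + L <= S w)%R] <= (expR (- L))%:E)%E.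
Proof.
move=> fB fS Bb.
pose Sn n w := \sum_(1 <= j < n.+1) f j (count_of N U j w).
have mSn n : measurable_fun [set: T] (Sn n) by exact: measurable_occupancy_sum.
have SnS w : Sn n w @[n --> \oo] --> S w.
  by have := fS w; rewrite -cvg_shiftS.
have mS := measurable_occupancy_limit fS.
have meS : measurable_fun [set: T] (fun w => (expR (S w))%:E).
  by apply/measurable_EFinP; exact: measurableT_comp.
have mset : measurable [set w | b + L <= S w].
  rewrite (_ : [set w | _] = [set: T] `&` S @^-1` `[b + L, +oo[%classic).
    exact: mS.
  by rewrite setTI; apply/seteqP; split=> w /=; rewrite in_itv/= andbT.
split=> //.
have intS : (\int[P]_w (expR (S w))%:E <= (expR b)%:E)%E.
  (* S is a pointwise limit of the finite sums, so its exponential is a limit inferior to which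
     Fatou's lemma applies. *)
  rewrite (eq_integral (fun w => limn_einf (fun n => (expR (Sn n w))%:E))); last first.
    move=> w _; apply/esym; apply: (cvg_limn_einf_sup _).1.
    apply: cvg_EFin; first exact: nearW.
    by apply: continuous_cvg; [exact: continuous_expR|exact: SnS].
  apply: (le_trans (@fatou _ _ _ P _ measurableT (fun n w => (expR (Sn n w))%:E) _ _)).
  - by move=> n; apply/measurable_EFinP; exact: measurableT_comp.
  - by move=> n w _; rewrite lee_fin expR_ge0.
  have bound n : (\int[P]_w (expR (Sn n w))%:E <=
      (expR (\sum_(1 <= j < n.+1) B j))%:E)%E.
    under eq_integral do rewrite /Sn expR_sum.
    rewrite expR_sum; apply: (@integral_prod_count_of_le n (fun j k => expR (f j k))).
      by move=> j k; exact: expR_ge0.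
    exact: fB.
  have cvgB : ((expR (\sum_(1 <= j < n.+1) B j))%:E @[n --> \oo] --> (expR b)%:E)%E.
    apply: cvg_EFin; first exact: nearW.
    apply: continuous_cvg; first exact: continuous_expR.
    by move: Bb; rewrite -cvg_shiftS.
  rewrite limn_einf_lim -(cvg_lim _ cvgB)//; apply: lee_lim.
  - exact: is_cvg_einfs.
  - by apply/cvg_ex; eexists; exact: cvgB.
  apply: nearW => n; apply: le_trans (bound n).
  by apply: ereal_inf_lbound; exists n => /=.
have eb0 : 0 < expR (b + L) by exact: expR_gt0.
(* Markov's inequality at the threshold exp (b + L). *)
have := @le_integral_abse _ _ _ P _ measurableT _ (expR (b + L)) meS eb0.
rewrite setTI (_ : [set x | _] = [set w | b + L <= S w]); last first.
  by apply/seteqP; split=> w /=; rewrite lee_fin ger0_norm ?expR_ge0// ler_expR.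
under eq_integral do rewrite gee0_abs ?lee_fin ?expR_ge0//.
move=> /le_trans /(_ intS).
have -> : expR b = expR (b + L) * expR (- L) by rewrite -expRD addrK.
by rewrite EFinM lee_pmul2l.
Qed.
End joint_law.

(** * Nonnegative series with bounded partial sums *)

Section nonneg_series.
Context {R : realType}.
Implicit Types (u : nat -> R) (C : R).

(** Has the shape of K, K_r and M_0, so one convergence lemma serves them and their deterministic
    counterparts. *)
Definition series_from1 u : R := fine (\sum_(1 <= j <oo) (u j)%:E)%E.

Lemma cvg_series_from1 u C : (forall j, (0 < j)%N -> 0 <= u j) ->
  (forall n, \sum_(1 <= j < n) u j <= C) ->
  \sum_(1 <= j < n) u j @[n --> \oo] --> series_from1 u.
Proof.
move=> u0 uC.
have u0' n : (1 <= n)%N -> true -> (0 <= (u n)%:E)%E.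
  by move=> n0 _; rewrite lee_fin u0.
have cv := is_cvg_nneseries u0'.
(* Finiteness matters: [fine] would send an infinite sum to 0. *)
have fin : (\sum_(1 <= j <oo) (u j)%:E)%E \is a fin_num.
  rewrite ge0_fin_numE; last by apply: nneseries_ge0.
  apply: (@le_lt_trans _ _ C%:E); last exact: ltry.
  by apply: lime_le => //; apply: nearW => n; rewrite sumEFin lee_fin.
rewrite (_ : (fun n => _) = fine \o (fun n => \sum_(1 <= j < n) (u j)%:E)%E); last first.
  by apply/funext => n /=; rewrite sumEFin.
by apply: fine_cvg; rewrite fineK.
Qed.

Lemma series_from1_ge u C j : (forall j, (0 < j)%N -> 0 <= u j) ->
  (forall n, \sum_(1 <= j < n) u j <= C) -> (0 < j)%N -> u j <= series_from1 u.
Proof.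
move=> u0 uC j0; apply: (cvgr_to_ge (cvg_series_from1 u0 uC)).
exists j.+1 => // n /= jn.
rewrite (@big_cat_nat _ _ _ j.+1)//= big_nat_recr//=.
have s0 a b : (0 < a)%N -> 0 <= \sum_(a <= i < b) u i.
  move=> a0; rewrite big_nat_cond; apply: sumr_ge0 => i /andP[/andP[ai _] _].
  by rewrite u0// (leq_trans a0).
by have := s0 1%N j isT; have := s0 j.+1 n isT; lra.
Qed.

End nonneg_series.

(** * Exponential moments of functions of a Poisson variable *)

Section poisson_mgf.
Context {R : realType}.
Implicit Types (m r c : R) (g : nat -> R).

(** Replacing g by the constant r gives at most r e^m, and only k = 0, 1, 2 need a correction. *)
Lemma poisson_sum_le m r g M : 0 <= m -> 0 <= r -> (forall k, 0 <= g k) ->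
  (forall k, (2 < k)%N -> g k = r) ->
  \sum_(k < M) m ^+ k / k`!%:R * g k <=
  expR m * r + (g 0%N - r) + m * (g 1%N - r) + m ^+ 2 / 2 * (g 2%N - r).
Proof.
move=> m0 r0 g0 gr.
have c0 k : 0 <= m ^+ k / k`!%:R by rewrite divr_ge0// exprn_ge0.
rewrite -(big_mkord xpredT (fun k => m ^+ k / k`!%:R * g k)).
(* Adding three nonnegative terms makes k = 0, 1, 2 present even for small M. *)
apply: (@le_trans _ _ (\sum_(0 <= k < M.+3) m ^+ k / k`!%:R * g k)).
  rewrite [leRHS](@big_cat_nat _ _ _ M)//=; last by rewrite -addn3 leq_addr.
  by rewrite lerDl sumr_ge0// => k _; rewrite mulr_ge0.
have eM := series_exp_coeff_le_expR M.+3 m0.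
have {eM} := ler_wpM2r r0 eM.
rewrite !big_nat_recl//=.
have -> : \sum_(0 <= i < M) m ^+ i.+3 / i.+3`!%:R * g i.+3 =
    \sum_(0 <= i < M) m ^+ i.+3 / i.+3`!%:R * r.
  by apply: eq_bigr => i _; rewrite gr.
rewrite -mulr_suml expr0 expr1 !divr1.
by have -> : 2`!%:R = 2 :> R by []; lra.
Qed.

(** The hypothesis says E e^f(X) <= 1 + c for X Poisson of mean m; then 1 + c <= e^c puts the bound
    in the form that [chernoff_occupancy] expects. *)
Lemma poisson_mgf_le m r c (f : nat -> R) M : 0 <= m ->
  (forall k, (2 < k)%N -> f k = r) ->
  expR r + expR (- m) * ((expR (f 0%N) - expR r) + m * (expR (f 1%N) - expR r) +
    m ^+ 2 / 2 * (expR (f 2%N) - expR r)) <= 1 + c ->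
  \sum_(k < M) m ^+ k / k`!%:R * expR (f k) <= expR m * expR c.
Proof.
move=> m0 fr /le_trans/(_ (expR_ge1Dx c)) H.
have := @poisson_sum_le m (expR r) (expR \o f) M m0 (expR_ge0 _)
  (fun k => expR_ge0 _) (fun k k2 => congr1 expR (fr k k2)).
move=> /le_trans; apply => /=.
have := ler_wpM2l (expR_ge0 m) H.
by rewrite mulrDr mulrA expRxMexpNx_1 mul1r; lra.
Qed.

End poisson_mgf.

(** * Deterministic counterparts of K and K_1 + 2 K_2 *)

Section occupancy_means.
Context {R : realType}.
Variables (p : nat -> R) (t : R).

(** P(X_j > 0), so that the series is E K. *)
Definition distinct_mean_term j : R := 1 - expR (- (t * p j)).
Definition distinct_mean : R := series_from1 distinct_mean_term.

(* P(X = 1) + 2 * P(X = 2) for X Poisson of mean t * p j: the j-th term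
   of E(K_1 + 2 K_2), which is also the variance of t M_0 - K_1. *)
Definition good_turing_variance_term j : R :=
  expR (- (t * p j)) * (t * p j + (t * p j) ^+ 2).
Definition good_turing_variance : R := series_from1 good_turing_variance_term.

End occupancy_means.

(** * Tail bounds for the occupancy statistics *)

Section urn_concentration.
Context (R : realType) (d : measure_display) (T : measurableType d).
Context (P : probability T R) (p : nat -> R) (t : R).
Context (N : {RV P >-> nat}) (U : nat -> {RV P >-> nat}).
Hypotheses (t_gt0 : 0 < t) (urn : poisson_urn p t N U).

Local Notation K := (distinct_symbols R N U).
Local Notation K_ := (distinct_symbols_seen R N U).
Local Notation M0 := (missing_mass p N U).
Local Notation v_ := (distinct_mean_term p t).
Local Notation v := (distinct_mean p t).
Local Notation u_ := (good_turing_variance_term p t).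
Local Notation u := (good_turing_variance p t).

Lemma urn_p_ge0 j : (0 < j)%N -> 0 <= p j.
Proof. exact: (urn_pmf urn).1. Qed.

Lemma urn_mean_ge0 j : (0 < j)%N -> 0 <= t * p j.
Proof. by move=> j0; apply: mulr_ge0; [exact: ltW|exact: urn_p_ge0]. Qed.

Lemma sum_urn_p_le1 n : \sum_(1 <= j < n) p j <= 1.
Proof.
rewrite -lee_fin -(urn_pmf urn).2 -sumEFin; apply: nneseries_lim_ge => j j0 _.
by rewrite lee_fin urn_p_ge0.
Qed.

(** Makes E K and E (K_1 + 2 K_2) positive, so that the optimal Chernoff parameters can be formed by
    division. *)
Lemma urn_p_gt0 : exists2 j, (0 < j)%N & 0 < p j.
Proof.
apply: contrapT => np; have := (urn_pmf urn).2; rewrite eseries0.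
  by move=> /eqP; rewrite eqe eq_sym oner_eq0.
move=> j j0 _; congr (_%:E); apply/eqP.
rewrite eq_le urn_p_ge0// andbT leNgt; apply/negP => pj.
by apply: np; exists j.
Qed.

Lemma sum_count_of_le n w : (\sum_(1 <= j < n) count_of N U j w <= N w)%N.
Proof.
rewrite /count_of exchange_big/=.
rewrite -[leqRHS]card_ord -sum1_card; apply: leq_sum => i _.
rewrite (eq_bigr (fun j => if j == U i w then 1%N else 0%N)); last first.
  by move=> j _; rewrite eq_sym; case: eqP.
by rewrite -big_mkcond sum1_count count_uniq_mem ?iota_uniq// leq_b1.
Qed.

Lemma cvg_distinct_symbols w :
  \sum_(1 <= j < n) (0 < count_of N U j w)%N%:R @[n --> \oo] --> K w.
Proof.
apply: (@cvg_series_from1 _ _ (N w)%:R) => [j _|n]; first exact: ler0n.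
rewrite -natr_sum ler_nat; apply: leq_trans (sum_count_of_le n w).
by apply: leq_sum => j _; case: (count_of _ _ _ _).
Qed.

(** For r > 0 at most [N w] symbols count; at r = 0 the series would diverge, all but finitely many
    symbols being unseen. *)
Lemma cvg_distinct_symbols_seen r w : (0 < r)%N ->
  \sum_(1 <= j < n) (count_of N U j w == r)%:R @[n --> \oo] --> K_ r w.
Proof.
move=> r0.
apply: (@cvg_series_from1 _ _ (N w)%:R) => [j _|n]; first exact: ler0n.
rewrite -natr_sum ler_nat; apply: leq_trans (sum_count_of_le n w).
by apply: leq_sum => j _; case: eqP => // ->.
Qed.

Lemma cvg_missing_mass w :
  \sum_(1 <= j < n) p j * (count_of N U j w == 0%N)%:R @[n --> \oo] --> M0 w.
Proof.
apply: (@cvg_series_from1 _ _ 1) => [j j0|n]; first by rewrite mulr_ge0// urn_p_ge0.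
apply: le_trans (sum_urn_p_le1 n); rewrite big_nat [leRHS]big_nat.
apply: ler_sum => j /andP[j0 _].
by rewrite ler_piMr ?urn_p_ge0// lern1 leq_b1.
Qed.

Lemma distinct_symbols_ge0 w : 0 <= K w.
Proof. by apply: fine_ge0; apply: nneseries_ge0 => j _ _; rewrite lee_fin ler0n. Qed.

Lemma distinct_symbols_seen_ge0 r w : 0 <= K_ r w.
Proof. by apply: fine_ge0; apply: nneseries_ge0 => j _ _; rewrite lee_fin ler0n. Qed.

Lemma distinct_mean_term_ge0 j : (0 < j)%N -> 0 <= v_ j.
Proof. by move=> j0; rewrite subr_ge0 expR_le1 oppr_le0 urn_mean_ge0. Qed.

Lemma sum_distinct_mean_term_le n : \sum_(1 <= j < n) v_ j <= t.
Proof.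
apply: (@le_trans _ _ (t * \sum_(1 <= j < n) p j)); last first.
  by rewrite ler_piMr ?sum_urn_p_le1// ltW.
rewrite mulr_sumr; apply: ler_sum => j _.
by have := expR_ge1Dx (- (t * p j)); rewrite /distinct_mean_term; lra.
Qed.

Lemma good_turing_variance_term_ge0 j : (0 < j)%N -> 0 <= u_ j.
Proof. by move=> j0; rewrite mulr_ge0 ?expR_ge0// addr_ge0 ?sqr_ge0// urn_mean_ge0. Qed.

Lemma sum_good_turing_variance_term_le n : \sum_(1 <= j < n) u_ j <= 2 * t.
Proof.
apply: (@le_trans _ _ (2 * t * \sum_(1 <= j < n) p j)); last first.
  by rewrite ler_piMr ?sum_urn_p_le1// mulr_ge0// ltW.
rewrite mulr_sumr big_nat [leRHS]big_nat; apply: ler_sum => j /andP[j0 _].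
rewrite /good_turing_variance_term -mulrA; set m := t * p j.
have m0 : 0 <= m by exact: urn_mean_ge0.
have : expR (- m) * (m + m ^+ 2) <= m.
  rewrite (_ : m + m ^+ 2 = (1 + m) * m); last by ring.
  rewrite mulrA ler_piMl// -[leRHS](expR0 R) -(addNr m) expRD.
  by rewrite ler_wpM2l ?expR_ge0// expR_ge1Dx.
by lra.
Qed.

Lemma distinct_mean_gt0 : 0 < v.
Proof.
have [j j0 pj] := urn_p_gt0.
apply: lt_le_trans (series_from1_ge distinct_mean_term_ge0
  sum_distinct_mean_term_le j0).
by rewrite subr_gt0 expR_lt1 oppr_lt0 mulr_gt0.
Qed.

Lemma good_turing_variance_gt0 : 0 < u.
Proof.
have [j j0 pj] := urn_p_gt0.
apply: lt_le_trans (series_from1_ge good_turing_variance_term_ge0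
  sum_good_turing_variance_term_le j0).
by rewrite mulr_gt0 ?expR_gt0// addr_gt0 ?exprn_gt0// mulr_gt0.
Qed.

Lemma cvg_distinct_mean : \sum_(1 <= j < n) v_ j @[n --> \oo] --> v.
Proof. exact: cvg_series_from1 distinct_mean_term_ge0 sum_distinct_mean_term_le. Qed.

Lemma cvg_good_turing_variance : \sum_(1 <= j < n) u_ j @[n --> \oo] --> u.
Proof.
exact: cvg_series_from1 good_turing_variance_term_ge0
  sum_good_turing_variance_term_le.
Qed.

Lemma missing_mass_right_tail s L : 0 < s <= 1 ->
  let A := [set w | s ^+ 2 * v + L <= s * (t * M0 w - K_ 1%N w)] in
  measurable A /\ (P A <= (expR (- L))%:E)%E.
Proof.
move=> /andP[s0 s1] A.
pose f (j k : nat) : R := s * (t * p j * (k == 0%N)%:R - (k == 1%N)%:R).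
apply: (chernoff_occupancy t_gt0 urn (f := f)
  (B := fun j => s ^+ 2 * v_ j)) => [j M j0|w|].
- apply: (@poisson_mgf_le _ _ 0 _ (f j)); first exact: urn_mean_ge0.
    by move=> [|[|[|k]]]//= _; rewrite /f/= mulr0 subrr mulr0.
  rewrite /f/= !(mulr1, mulr0, subr0, sub0r, mulrN, oppr0, expR0, subrr, addr0).
  rewrite lerD2l.
  exact: missing_mass_mgf_le (ltW s0) s1 (urn_mean_ge0 j0).
- rewrite (_ : (fun n => _) = (fun n => s *
    (t * (\sum_(1 <= j < n) p j * (count_of N U j w == 0%N)%:R) -
     \sum_(1 <= j < n) (count_of N U j w == 1%N)%:R))).
    apply: cvgMl_tmp; apply: cvgB; last exact: cvg_distinct_symbols_seen.
    by apply: cvgMl_tmp; exact: cvg_missing_mass.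
  apply/funext => n; rewrite mulr_sumr -sumrB mulr_sumr; apply: eq_bigr => j _.
  by rewrite mulrA.
- rewrite (_ : (fun n => _) = (fun n => s ^+ 2 * \sum_(1 <= j < n) v_ j)).
    by apply: cvgMl_tmp; exact: cvg_distinct_mean.
  by apply/funext => n; rewrite mulr_sumr.
Qed.

Lemma missing_mass_left_tail s L : 0 < s < 1 ->
  let A := [set w | s ^+ 2 / (2 * (1 - s)) * u + L <= s * (K_ 1%N w - t * M0 w)] in
  measurable A /\ (P A <= (expR (- L))%:E)%E.
Proof.
move=> /andP[s0 s1] A.
pose f (j k : nat) : R := s * ((k == 1%N)%:R - t * p j * (k == 0%N)%:R).
apply: (chernoff_occupancy t_gt0 urn (f := f)
  (B := fun j => s ^+ 2 / (2 * (1 - s)) * u_ j)) => [j M j0|w|].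
- apply: (@poisson_mgf_le _ _ 0 _ (f j)); first exact: urn_mean_ge0.
    by move=> [|[|[|k]]]//= _; rewrite /f/= mulr0 subrr mulr0.
  rewrite /f/= !(mulr1, mulr0, subr0, sub0r, mulrN, oppr0, expR0, subrr, addr0).
  rewrite lerD2l.
  exact: good_turing_mgf_le (ltW s0) s1 (urn_mean_ge0 j0).
- rewrite (_ : (fun n => _) = (fun n => s *
    (\sum_(1 <= j < n) (count_of N U j w == 1%N)%:R -
     t * (\sum_(1 <= j < n) p j * (count_of N U j w == 0%N)%:R)))).
    apply: cvgMl_tmp; apply: cvgB; first exact: cvg_distinct_symbols_seen.
    by apply: cvgMl_tmp; exact: cvg_missing_mass.
  apply/funext => n; rewrite mulr_sumr -sumrB mulr_sumr; apply: eq_bigr => j _.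
  by rewrite mulrA.
- rewrite (_ : (fun n => _) =
    (fun n => s ^+ 2 / (2 * (1 - s)) * \sum_(1 <= j < n) u_ j)).
    by apply: cvgMl_tmp; exact: cvg_good_turing_variance.
  by apply/funext => n; rewrite mulr_sumr.
Qed.

Lemma distinct_symbols_left_tail s L : 0 < s ->
  let A := [set w | v * (- s + s ^+ 2 / 2) + L <= - (s * K w)] in
  measurable A /\ (P A <= (expR (- L))%:E)%E.
Proof.
move=> s0 A.
pose f (j k : nat) : R := - (s * (0 < k)%N%:R).
apply: (chernoff_occupancy t_gt0 urn (f := f)
  (S := fun w => - (s * K w)) (B := fun j => v_ j * (- s + s ^+ 2 / 2))) => [j M j0|w|].
(* The function equals - s at every k >= 1, so its constant value beyond 2 is - s, where the other
   tails have 0. *)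
- apply: (@poisson_mgf_le _ _ (- s) _ (f j)); first exact: urn_mean_ge0.
    by move=> [|k]//= _; rewrite /f/= mulr1.
  rewrite /f/= !(mulr1, mulr0, oppr0, expR0, subrr, addr0).
  have := bernoulli_mgf_le (ltW s0) (distinct_mean_term_ge0 j0).
  by rewrite /distinct_mean_term; lra.
- rewrite (_ : (fun n => _) = (fun n =>
    - (s * \sum_(1 <= j < n) (0 < count_of N U j w)%N%:R))).
    by apply: cvgN; apply: cvgMl_tmp; exact: cvg_distinct_symbols.
  by apply/funext => n; rewrite mulr_sumr -sumrN.
- rewrite (_ : (fun n => _) = (fun n =>
    (\sum_(1 <= j < n) v_ j) * (- s + s ^+ 2 / 2))).
    exact: (cvgMr_tmp cvg_distinct_mean).
  by apply/funext => n; rewrite mulr_suml.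
Qed.

Lemma good_turing_variance_left_tail s L : 0 < s ->
  let A := [set w | (- s + s ^+ 2) * u + L <= - (s * (K_ 1%N w + 2 * K_ 2%N w))] in
  measurable A /\ (P A <= (expR (- L))%:E)%E.
Proof.
move=> s0 A.
pose f (j k : nat) : R := - (s * ((k == 1%N)%:R + 2 * (k == 2%N)%:R)).
apply: (chernoff_occupancy t_gt0 urn (f := f)
  (S := fun w => - (s * (K_ 1%N w + 2 * K_ 2%N w)))
  (B := fun j => (- s + s ^+ 2) * u_ j)) => [j M j0|w|].
- apply: (@poisson_mgf_le _ _ 0 _ (f j)); first exact: urn_mean_ge0.
    by move=> [|[|[|k]]]//= _; rewrite /f/= mulr0 addr0 mulr0 oppr0.
  rewrite /f/= !(mulr1, mulr0, oppr0, expR0, subrr, addr0, add0r).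
  rewrite lerD2l.
  exact: good_turing_variance_mgf_le (ltW s0) (urn_mean_ge0 j0).
- rewrite (_ : (fun n => _) = (fun n => - (s *
    (\sum_(1 <= j < n) (count_of N U j w == 1%N)%:R +
     2 * \sum_(1 <= j < n) (count_of N U j w == 2%N)%:R)))).
    apply: cvgN; apply: cvgMl_tmp; apply: cvgD; first exact: cvg_distinct_symbols_seen.
    by apply: cvgMl_tmp; exact: cvg_distinct_symbols_seen.
  by apply/funext => n; rewrite [2 * _]mulr_sumr -big_split/= mulr_sumr -sumrN.
- rewrite (_ : (fun n => _) = (fun n => (- s + s ^+ 2) * \sum_(1 <= j < n) u_ j)).
    by apply: cvgMl_tmp; exact: cvg_good_turing_variance.
  by apply/funext => n; rewrite mulr_sumr.
Qed.

Lemma measurable_distinct_symbols : measurable_fun [set: T] K.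
Proof.
exact: (measurable_occupancy_limit (f := fun _ k => (0 < k)%N%:R)
  cvg_distinct_symbols).
Qed.

Lemma measurable_distinct_symbols_seen r : (0 < r)%N -> measurable_fun [set: T] (K_ r).
Proof.
move=> r0; apply: (measurable_occupancy_limit (f := fun _ k => (k == r)%:R)) => w.
exact: cvg_distinct_symbols_seen.
Qed.

Lemma measurable_missing_mass : measurable_fun [set: T] M0.
Proof.
exact: (measurable_occupancy_limit (f := fun j k => p j * (k == 0%N)%:R)
  cvg_missing_mass).
Qed.

End urn_concentration.

(** * Union bound over the four tail events *)

Unset Implicit Arguments.

Theorem proposition5p5 (R : realType) (d : measure_display)
    (T : measurableType d) (P : probability T R)
    (p : nat -> R) (t : R) (N : {RV P >-> nat}) (U : nat -> {RV P >-> nat})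
    (delta : R)
    (t_gt0 : 0 < t) (urn : poisson_urn p t N U)
    (delta_gt0 : 0 < delta) (delta_lt1 : delta < 1) :
  let K : T -> R := distinct_symbols R N U in
  let K_ : nat -> T -> R := distinct_symbols_seen R N U in
  let M0 : T -> R := missing_mass p N U in
  let G0 : T -> R := good_turing t N U in
  let L : R := ln (1 / delta) in
  ((1 - 4 * delta)%:E <=
   P [set w |
       (M0 w <= G0 w + 1 / t * (Num.sqrt (6 * K w * L) + 5 * L))%R /\
       (M0 w >= G0 w - 1 / t *
          (Num.sqrt (2 * (K_ 1%N w + 2 * K_ 2%N w) * L) + 4 * L))%R])%E.
Proof.
cbv zeta.
set K := distinct_symbols R N U; set K_ := distinct_symbols_seen R N U.
set M0 := missing_mass p N U; set G0 := good_turing t N U.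
set L := ln (1 / delta); set good := [set w | _].
have L0 : 0 < L by rewrite ln_gt0// div1r invf_gt1.
have expL : expR (- L) = delta by rewrite expRN lnK ?posrE ?divr_gt0// div1r invrK.
have v0 := distinct_mean_gt0 t_gt0 urn; have u0 := good_turing_variance_gt0 t_gt0 urn.
set v := distinct_mean p t in v0; set u := good_turing_variance p t in u0.
(* The parameters depend on v, u and L only, hence not on the sample. *)
have [s1 s1i opt1] := chernoff_opt_missing_mass v0 L0.
have [s2 s2i opt2] := chernoff_opt_gaussian_lower v0 L0.
have [s3 s3i opt3] := chernoff_opt_subgamma u0 L0.
have [s4 s4i opt4] := chernoff_opt_subgaussian_lower u0 L0.
have [mA1 PA1] := missing_mass_right_tail t_gt0 urn L s1i.
have [mA2 PA2] := distinct_symbols_left_tail t_gt0 urn L s2i.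
have [mA3 PA3] := missing_mass_left_tail t_gt0 urn L s3i.
have [mA4 PA4] := good_turing_variance_left_tail t_gt0 urn L s4i.
move: mA1 PA1 mA2 PA2 mA3 PA3 mA4 PA4; rewrite expL.
set A1 := [set w | _]; set A2 := [set w | _].
set A3 := [set w | _]; set A4 := [set w | _] => mA1 PA1 mA2 PA2 mA3 PA3 mA4 PA4.
have mbad : measurable (A1 `|` A2 `|` (A3 `|` A4)) by do !apply: measurableU.
have Pbad : (P (A1 `|` A2 `|` (A3 `|` A4)) <= (4 * delta)%:E)%E.
  have -> : 4 * delta = (delta + delta) + (delta + delta) by ring.
  rewrite !EFinD; apply: (le_trans (measureU2 _ _ _)); [exact: measurableU..|].
  by apply: leeD; apply: (le_trans (measureU2 _ _ _)) => //; exact: leeD.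
have K0 w : 0 <= K w := distinct_symbols_ge0 N U w.
have Kr0 r w : 0 <= K_ r w := distinct_symbols_seen_ge0 N U r w.
(* Off the bad events the deviation bounds hold with v and u, and the plug-in lemmas replace these
   by K and K_1 + 2 K_2; dividing by t gives the claim. *)
have bad_good : ~` (A1 `|` A2 `|` (A3 `|` A4)) `<=` good.
  rewrite !setCU => w [[/= nA1 nA2] [nA3 nA4]].
  have {nA1}/opt1 dev1 : s1 * (t * M0 w - K_ 1%N w) < s1 ^+ 2 * v + L.
    by rewrite ltNge; apply/negP.
  have {nA2}/opt2 dev2 : - (s2 * K w) < v * (- s2 + s2 ^+ 2 / 2) + L.
    by rewrite ltNge; apply/negP.
  have {nA3}/opt3 dev3 : s3 * (K_ 1%N w - t * M0 w) < s3 ^+ 2 / (2 * (1 - s3)) * u + L.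
    by rewrite ltNge; apply/negP.
  have {nA4}/opt4 dev4 :
      - (s4 * (K_ 1%N w + 2 * K_ 2%N w)) < (- s4 + s4 ^+ 2) * u + L.
    by rewrite ltNge; apply/negP.
  have up := le_trans dev1 (deviation_plugin_upper (ltW v0) (K0 w) L0 dev2).
  have W0 : 0 <= K_ 1%N w + 2 * K_ 2%N w by rewrite addr_ge0// mulr_ge0.
  have lo := le_trans dev3 (deviation_plugin_lower (ltW u0) W0 L0 dev4).
  rewrite /good/= /G0 /good_turing -/(K_ 1%N w); split.
    rewrite mul1r [_^-1 * _]mulrC -mulrDl ler_pdivlMr//.
    by move: up; lra.
  rewrite mul1r [_^-1 * _]mulrC -mulrBl ler_pdivrMr//.
  by move: lo; lra.
have mK := measurable_distinct_symbols N U.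
have mK_ r (r0 : (0 < r)%N) := measurable_distinct_symbols_seen N U r0.
have mM0 := measurable_missing_mass urn.
have msqrt : measurable_fun [set: R] Num.sqrt.
  by apply: continuous_measurable_fun; exact: sqrt_continuous.
(* Needed for monotonicity of P, as the inclusion only bounds the good event from inside. *)
have mgood : measurable good.
  have mG0 : measurable_fun [set: T] G0.
    by apply: measurable_funM; [exact: mK_|exact: measurable_cst].
  have mdev (c : R) (X : T -> R) : measurable_fun [set: T] X ->
      measurable_fun [set: T] (fun w => 1 / t * (Num.sqrt (X w * L) + c * L)).
    move=> mX; apply: measurable_funM => //; apply: measurable_funD => //.
    by apply: (measurableT_comp msqrt); apply: measurable_funM.
  have -> : good = ([set: T] `&` [set w | M0 w <=
        G0 w + 1 / t * (Num.sqrt (6 * K w * L) + 5 * L)]) `&`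
      ([set: T] `&` [set w | G0 w - 1 / t *
        (Num.sqrt (2 * (K_ 1%N w + 2 * K_ 2%N w) * L) + 4 * L) <= M0 w]).
    by rewrite !setTI.
  apply: measurableI; apply: measurable_fun_le => //.
    by apply: measurable_funD => //; apply: mdev; exact: measurable_funM.
  apply: measurable_funB => //; apply: mdev; apply: measurable_funM => //.
  apply: measurable_funD; first exact: mK_.
  by apply: measurable_funM => //; exact: mK_.
apply: (@le_trans _ _ (P (~` (A1 `|` A2 `|` (A3 `|` A4))))).
  by rewrite probability_setC// EFinB leeB.
by apply: le_measure; rewrite ?inE//; exact: measurableC.
Qed.
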